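(* Let $a$ be a real number that is algebraic over $\mathbb{Q}$, and let $\mathbb{Q}(a)^+=\{x\in\mathbb{Q}(a): x>0\}$. Then $\mathbb{Q}(a)^+$ cannot be written as $H_1\sqcup H_2$ with $H_1,H_2$ disjoint nonempty subsets, each closed under addition and multiplication. *)

(* Defs.v *)
From mathcomp Require Import all_boot all_order all_algebra.
From mathcomp Require Import reals.
Set Implicit Arguments. Unset Strict Implicit. Unset Printing Implicit Defensive.
Import Order.TTheory GRing.Theory Num.Theory.
Local Open Scope ring_scope.

Definition algebraic_over_Q (R : realType) (a : R) : Prop :=
  exists p : {poly rat}, p != 0 /\ root (map_poly ratr p) a.

Definition Qadj (R : realType) (a : R) : R -> Prop :=
  fun x => exists p q : {poly rat},
    (map_poly ratr q).[a] != 0 /\ x = (map_poly ratr p).[a] / (map_poly ratr q).[a].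

Definition Qadj_pos (R : realType) (a : R) : R -> Prop :=
  fun x => Qadj a x /\ 0 < x.

Definition add_mul_closed (R : realType) (H : R -> Prop) : Prop :=
  forall x y, H x -> H y -> H (x + y) /\ H (x * y).

(* Main.v *)
(** Let [1] lie in [H1] and [x] in [H2].  Replacing the sign of the elements of [H2]
    gives a total order on the [rat]-space [rat(x)] with nonnegative cone
    [H1 \cup -H2 \cup {0}]; finite dimension provides an element dominating all the
    others, hence a nonzero additive [f] to the reals that is [>= 0] on [H1] and [<= 0]
    on [H2].  Put [F z = f z - z * f 1].  If [F z > 0], then for rationals [q < z < q']
    close to [z] one has [z - q] in [H1] and [q' - z] in [H2], so that
    [f ((z - q)^2) >= 0 >= f ((q' - z)^2)]; in the limit
    [f (z^2) - 2 * z * f z + z^2 * f 1 = 0].  Polarizing, [F] is a derivation of an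
    algebraic extension of [rat], so [F = 0] and [f] is a multiple of the
    inclusion in the reals, which cannot be [<= 0] at [x]. *)
Require Import Defs.
From mathcomp Require Import all_boot all_order all_algebra.
From mathcomp Require Import classical_sets reals.
From mathcomp Require Import ring lra.
Import Order.TTheory GRing.Theory Num.Theory.
Local Open Scope ring_scope.

(** * Positive functionals on preordered rational vector spaces *)

Lemma additive_scale_rat (V : lmodType rat) (R : numFieldType) (f : V -> R) :
  {morph f : u v / u + v} -> forall c u, f (c *: u) = ratr c * f u.
Proof.
move=> fD c u.
have f0 : f 0 = 0 by apply: (addrI (f 0)); rewrite -fD !addr0.
have fN v : f (- v) = - f v by apply/eqP; rewrite -addr_eq0 -fD addNr f0.
have fn v n : f (v *+ n) = f v *+ n.
  by elim: n => [|n IHn]; rewrite ?mulr0n ?f0 // !mulrSr fD IHn.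
have fz v (n : int) : f (v *~ n) = f v *~ n.
  by case: n => n; rewrite ?NegzE ?mulrNz ?fN -!pmulrn fn.
have dn0 : (denq c)%:~R != 0 :> R by rewrite intr_eq0 denq_neq0.
apply: (mulfI dn0).
rewrite mulrzl -fz -scaler_int scalerA mulrC -numqE scaler_int fz mulrA.
by rewrite -(ratr_int R (denq c)) -rmorphM [_ * c]mulrC -numqE /= ratr_int mulrzl.
Qed.

(* [f u] is the Dedekind cut of the rationals [q] with [q *: e] below [u] in the
   preorder with nonnegative cone [N]. *)
Lemma archimedean_functional (R : realType) (V : lmodType rat) (N : V -> Prop) (e : V) :
    (forall u v, N u -> N v -> N (u + v)) ->
    (forall q u, 0 <= q -> N u -> N (q *: u)) ->
    (forall u, N u \/ N (- u)) ->
    (forall u, exists q, N (q *: e - u)) ->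
    ~ N (- e) ->
  exists f : V -> R,
    [/\ {morph f : u v / u + v}, f e = 1 & forall u, N u -> 0 <= f u].
Proof.
move=> ND NZ Ntot Ndom Ne.
(* For negative [q], scaling [q *: e] by [- q^-1] would put [- e] in the cone. *)
have Npos q : N (q *: e) -> 0 <= q.
  move=> Nq; rewrite leNgt; apply/negP => q0; apply: Ne.
  have := NZ (- q^-1) _ _ Nq; rewrite scalerA mulNr mulVf ?lt_eqF // scaleN1r.
  by apply; rewrite oppr_ge0 invr_le0 ltW.
have N01 : N e by case: (Ntot e).
pose cut u (r : R) := (forall q, ratr q < r -> N (u - q *: e)) /\
                      (forall q, r < ratr q -> N (q *: e - u)).
(* Rationals [r < q1 < q2 < s] would put [(q1 - q2) *: e] in the cone, against [Npos]. *)
have cut_le u r s : cut u r -> cut u s -> s <= r.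
  move=> [_ ru] [su _]; rewrite leNgt; apply/negP => rs.
  have [q2 /[!in_itv] /= /andP[rq2 q2s]] := rat_in_itvoo rs.
  have [q1 /[!in_itv] /= /andP[rq1 q12]] := rat_in_itvoo rq2.
  have := ND _ _ (ru _ rq1) (su _ q2s); rewrite addrA subrK -scalerBl => /Npos.
  by rewrite subr_ge0 leNgt -(ltr_rat R) q12.
have cut_uniq u r s : cut u r -> cut u s -> r = s.
  by move=> ur us; apply/eqP; rewrite eq_le !(cut_le u).
pose S u : R -> Prop := fun r => exists2 q, r = ratr q & N (u - q *: e).
have S_ub u q : N (q *: e - u) -> forall r, S u r -> r <= ratr q.
  move=> Nq r [q' -> Nq']; have := ND _ _ Nq Nq'.
  by rewrite addrA subrK -scalerBl => /Npos; rewrite subr_ge0 ler_rat.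
have S_sup u : has_sup (S u).
  split; last by have [q /S_ub Nq] := Ndom u; exists (ratr q).
  have [q Nq] := Ndom (- u); exists (ratr (- q)), (- q) => //.
  by rewrite scaleNr opprK addrC -[u]opprK.
have cut_sup u : cut u (sup (S u)).
  split=> q qu.
    have su0 : 0 < sup (S u) - ratr q by rewrite subr_gt0.
    have [_ [q' -> Nq']] := sup_adherent su0 (S_sup u).
    rewrite subKr ltr_rat => qq'.
    have -> : u - q *: e = (u - q' *: e) + (q' - q) *: e.
      by rewrite scalerBl addrA subrK.
    by apply: ND => //; apply: NZ => //; rewrite subr_ge0 ltW.
  case: (Ntot (q *: e - u)) => //; rewrite opprB => Nq.
  have: ratr q <= sup (S u) by apply: ub_le_sup; [case: (S_sup u) | exists q].
  by rewrite leNgt qu.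
exists (fun u => sup (S u)); split.
(* A rational below the sum of the two suprema splits into one rational below each; likewise
   above. *)
- move=> u v; apply: (cut_uniq (u + v)); first exact: cut_sup.
  have [[lu gu] [lv gv]] := (cut_sup u, cut_sup v).
  split=> q.
    rewrite -ltrBlDr => /rat_in_itvoo[p /[!in_itv] /= /andP[p1 p2]].
    have -> : q = p + (q - p) by rewrite addrC subrK.
    rewrite scalerDl opprD addrACA; apply: ND; first exact: lu.
    by apply: lv; rewrite rmorphB /= ltrBlDr -ltrBlDl.
  rewrite -ltrBrDr => /rat_in_itvoo[p /[!in_itv] /= /andP[p1 p2]].
  have -> : q = p + (q - p) by rewrite addrC subrK.
  rewrite scalerDl opprD addrACA; apply: ND; first exact: gu.
  by apply: gv; rewrite rmorphB /= ltrBrDr -ltrBrDl.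
- apply: (cut_uniq e); first exact: cut_sup.
  split=> q; rewrite -(rmorph1 (@ratr R)) ltr_rat => q1.
    by rewrite -[X in X - _]scale1r -scalerBl; apply: NZ; rewrite // subr_ge0 ltW.
  by rewrite -[X in _ - X]scale1r -scalerBl; apply: NZ; rewrite // subr_ge0 ltW.
- move=> u Nu; apply: ub_le_sup; first by case: (S_sup u).
  by exists 0; rewrite ?rmorph0 // scale0r subr0.
Qed.

(** * From sign conditions on squares to a derivation *)

Lemma quadratic_pos_near (R : realFieldType) (A B C t : R) :
  0 < A + B * t + C * t ^+ 2 ->
  exists2 d, 0 < d & forall s, `|s - t| < d -> 0 < A + B * s + C * s ^+ 2.
Proof.
set v := A + _ + _ => v0; pose K := `|B + 2 * C * t| + `|C|.
have K1 : 0 < K + 1 by rewrite ltr_wpDl ?addr_ge0.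
(* Within distance 1 of [t] the quadratic changes by at most [K * |s - t|]; [K + 1] avoids dividing
   by zero. *)
exists (Num.min 1 (v / (K + 1))).
  by rewrite lt_min ltr01 divr_gt0.
move=> s; rewrite lt_min ltr_pdivlMr // => /andP[s1 sv].
have -> : A + B * s + C * s ^+ 2
    = v + (s - t) * (B + 2 * C * t + C * (s - t)) by rewrite /v; ring.
have : `|(s - t) * (B + 2 * C * t + C * (s - t))| < v.
  rewrite normrM; apply: le_lt_trans sv; apply: ler_wpM2l => //.
  apply: le_trans (ler_normD _ _) _; rewrite normrM /K.
  have : `|C| * `|s - t| <= `|C| by rewrite ler_piMr // ltW.
  by lra.
by rewrite ltr_norml => /andP[]; lra.
Qed.

Section Derivation.
Variables (R : realType) (x : R) (f : {poly rat} -> R).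
Local Notation ev p := (map_poly ratr p).[x].
Hypothesis fD : {morph f : u v / u + v}.
Hypothesis f_sqr_ge0 : forall u, 0 < ev u -> 0 < f u -> 0 <= f (u * u).
Hypothesis f_sqr_le0 : forall u, 0 < ev u -> f u < 0 -> f (u * u) <= 0.

Let fZ := additive_scale_rat _ _ f fD.

Let fN u : f (- u) = - f u.
Proof. by rewrite -scaleN1r fZ rmorphN rmorph1 mulN1r. Qed.

Let fB u v : f (u - v) = f u - f v.
Proof. by rewrite fD fN. Qed.

Let fC c : f c%:P = ratr c * f 1.
Proof. by rewrite -alg_polyC fZ. Qed.

Let F z := f z - ev z * f 1.

Let FD u v : F (u + v) = F u + F v.
Proof. by rewrite /F fD rmorphD hornerD; ring. Qed.

(** The limit of [f ((z - q)^2)] as the rational [q] tends to [ev z]. *)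
Let sqr_defect z := f (z * z) - 2 * ev z * f z + ev z ^+ 2 * f 1.

Let sqr_defect_pos z : 0 < F z -> sqr_defect z = 0.
Proof.
move=> Fz.
have f_sqr q : f ((z - q%:P) * (z - q%:P)) =
    f (z * z) + (- 2 * f z) * ratr q + f 1 * ratr q ^+ 2.
  have -> : (z - q%:P) * (z - q%:P) = z * z - (q *: z + q *: z) + (q * q)%:P.
    by rewrite -mul_polyC polyCM; ring.
  by rewrite fD fB fD fZ fC rmorphM /=; ring.
have ev_sub q : ev (z - q%:P) = ev z - ratr q.
  by rewrite rmorphB hornerD hornerN /= map_polyC hornerC.
have f_sub q : f (z - q%:P) = f z + (- f 1) * ratr q + 0 * ratr q ^+ 2.
  by rewrite fB fC; ring.
have [d1 d1_gt0 f_near] : exists2 d, 0 < d & forall s, `|s - ev z| < d ->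
    0 < f z + (- f 1) * s + 0 * s ^+ 2.
  by apply: quadratic_pos_near; move: Fz; rewrite /F; lra.
(* A negative defect is refuted by [z - q] with [q] just below [ev z], a positive one by [q - z]
   with [q] just above; in both cases [f (z - q)] is close to [F z], hence positive. *)
case: (ltrgtP (sqr_defect z) 0) => // Dz; exfalso.
  have [d2 d2_gt0 sqr_near] : exists2 d, 0 < d & forall s, `|s - ev z| < d ->
      0 < - f (z * z) + (2 * f z) * s + (- f 1) * s ^+ 2.
    by apply: quadratic_pos_near; move: Dz; rewrite /sqr_defect; lra.
  have : ev z - Num.min d1 d2 < ev z by rewrite ltrBlDr ltrDl lt_min d1_gt0.
  move=> /rat_in_itvoo[q /[!in_itv] /= /andP[]].
  rewrite ltrBlDr -ltrBlDl lt_min => /andP[q1 q2] qz.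
  have nq : `|ratr q - ev z| = ev z - ratr q.
    by rewrite distrC gtr0_norm ?subr_gt0.
  have := f_sqr_ge0 (z - q%:P); rewrite ev_sub f_sub f_sqr subr_gt0.
  move=> /(_ qz (f_near _ _)); rewrite nq => /(_ q1).
  have := sqr_near (ratr q); rewrite nq => /(_ q2); lra.
have [d2 d2_gt0 sqr_near] : exists2 d, 0 < d & forall s, `|s - ev z| < d ->
    0 < f (z * z) + (- 2 * f z) * s + f 1 * s ^+ 2.
  by apply: quadratic_pos_near; move: Dz; rewrite /sqr_defect; lra.
have : ev z < ev z + Num.min d1 d2 by rewrite ltrDl lt_min d1_gt0.
move=> /rat_in_itvoo[q /[!in_itv] /= /andP[qz]].
rewrite -ltrBlDl lt_min => /andP[q1 q2].
have nq : `|ratr q - ev z| = ratr q - ev z by rewrite gtr0_norm ?subr_gt0.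
have := f_sqr_le0 (- (z - q%:P)).
rewrite rmorphN hornerN ev_sub mulrNN fN f_sub f_sqr oppr_gt0 oppr_lt0 subr_lt0.
move=> /(_ qz (f_near _ _)); rewrite nq => /(_ q1).
have := sqr_near (ratr q); rewrite nq => /(_ q2); lra.
Qed.

(** [F] is odd and [sqr_defect] is even, so the sign of [F z] does not matter. *)
Let sqr_defect0 z : F z != 0 -> sqr_defect z = 0.
Proof.
have FN : F (- z) = - F z by rewrite /F fN rmorphN hornerN; ring.
have sN : sqr_defect (- z) = sqr_defect z.
  by rewrite /sqr_defect mulrNN fN rmorphN hornerN; ring.
rewrite neq_lt => /orP[|/sqr_defect_pos//]; rewrite -oppr_gt0 -FN.
by move/sqr_defect_pos; rewrite sN.
Qed.

Let derivation z : F z != 0 -> forall u v, F (u * v) = ev u * F v + ev v * F u.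
Proof.
move=> Fz.
have fM u v : f (v * u) = f (u * v) by rewrite mulrC.
have FN w : F (- w) = - F w by rewrite /F fN rmorphN hornerN; ring.
(* If [F w = 0], the defect vanishes at [w + z], [w - z] and [z], and the
   parallelogram law gives it at [w]. *)
have D0 w : sqr_defect w = 0.
  have [Fw|/sqr_defect0//] := eqVneq (F w) 0.
  have := sqr_defect0 (w + z); rewrite FD Fw add0r Fz => /(_ isT).
  have := sqr_defect0 (w - z); rewrite FD FN Fw add0r oppr_eq0 Fz => /(_ isT).
  have := sqr_defect0 _ Fz.
  rewrite /sqr_defect !mulrDl !mulrDr !mulrN !mulNr !opprK !fD !fN.
  rewrite !rmorphB !rmorphD !hornerD !hornerN (fM w z); lra.
(* Polarization: subtracting the defects of [u] and [v] from that of [u + v] leaves twice the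
   Leibniz identity. *)
move=> u v; have := D0 (u + v); have := D0 u; have := D0 v.
rewrite /F /sqr_defect rmorphM hornerM.
rewrite !mulrDl !mulrDr !fD !rmorphD !hornerD (fM u v); lra.
Qed.

(** Otherwise [F] is a nonzero derivation with [F u = u'(x) * F 'X], so every polynomial vanishing
    at [x] has a derivative vanishing at [x]. Differentiating [p] repeatedly then reaches, in
    characteristic zero, a nonzero constant that vanishes at [x]. *)
Lemma additive_eq_scaled_eval (p : {poly rat}) :
    p != 0 -> ev p = 0 -> (forall u, ev u = 0 -> f u = 0) ->
  forall z, f z = ev z * f 1.
Proof.
move=> p0 px f0 z; apply/eqP; rewrite -subr_eq0 -/(F z); apply: contraT => Fz.
have F_deriv u : F u = ev u^`() * F 'X.
  elim/poly_ind: u => [|u c IHu].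
    by rewrite deriv0 rmorph0 horner0 mul0r /F f0 ?rmorph0 ?horner0 // mul0r subr0.
  rewrite FD (derivation _ Fz) IHu derivMXaddC rmorphD hornerD rmorphM hornerM.
  by rewrite /F /= !map_polyX !hornerX map_polyC hornerC fC /=; ring.
have FX : F 'X != 0 by apply: contraNneq Fz => FX; rewrite F_deriv FX mulr0.
have F0 u : ev u = 0 -> ev u^`() = 0.
  move=> u0; apply: (mulIf FX); rewrite -F_deriv mul0r /F u0 f0 //; ring.
have [n] := ubnP (size p); elim: n => // n IHn in p p0 px *.
rewrite ltnS => pn.
have p1 : (1 < size p)%N.
  rewrite ltnNge; apply/negP => /size1_polyC pc; move: p0 px; rewrite pc.
  rewrite polyC_eq0 map_polyC hornerC /= => c0 /eqP.
  by rewrite fmorph_eq0 (negPf c0).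
apply: (IHn p^`()); last 1 first.
- exact: leq_trans (lt_size_deriv p0) pn.
- have : p^`()`_(size p).-2 != 0.
    rewrite coef_deriv -mulr_natr mulf_neq0 ?pnatr_eq0 //.
    by move: p0; rewrite -lead_coef_eq0 /lead_coef; case: (size p) p1 => [|[|k]].
  by apply: contraNneq => ->; rewrite coef0.
- exact: F0.
Qed.
End Derivation.

(** * The order defined by a partition *)

Lemma no_partition_with_one (R : realType) (x : R) (p : {poly rat}) (H1 H2 : R -> Prop) :
    let ev q := (map_poly ratr q).[x] in
    p != 0 -> ev p = 0 ->
    (forall q, 0 < ev q -> H1 (ev q) \/ H2 (ev q)) ->
    (forall y, H1 y -> 0 < y) -> (forall y, H2 y -> 0 < y) ->
    (forall y, ~ (H1 y /\ H2 y)) ->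
    add_mul_closed H1 -> add_mul_closed H2 ->
  H1 1 -> H2 x -> False.
Proof.
move=> ev p0 px H12 H1pos H2pos Hdisj H1c H2c H11 H2x.
have evD u v : ev (u + v) = ev u + ev v by rewrite /ev rmorphD hornerD.
have evN u : ev (- u) = - ev u by rewrite /ev rmorphN hornerN.
have evB u v : ev (u - v) = ev u - ev v by rewrite evD evN.
have evM u v : ev (u * v) = ev u * ev v by rewrite /ev rmorphM hornerM.
have evZ c u : ev (c *: u) = ratr c * ev u by rewrite /ev map_polyZ hornerZ.
have ev1 : ev 1 = 1 by rewrite /ev rmorph1 hornerC.
have evX : ev 'X = x by rewrite /ev map_polyX hornerX.
(* The nonnegative cone, pulled back along [ev]: polynomials represent [rat(x)], and those vanishing
   at [x] count as zero. *)
pose N u := [\/ ev u = 0, H1 (ev u) | H2 (- ev u)].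
(* A positive difference [h1 - h2] cannot lie in [H2], since adding [h2] would put
   [h1] there; symmetrically for [h2 - h1]. *)
have Nadd_mixed u v : H1 (ev u) -> H2 (- ev v) -> N (u + v).
  move=> Hu Hv; have evuv := evD u v; rewrite /N.
  case: (ltrgtP (ev (u + v)) 0) => [neg|pos|->]; last by constructor 1.
    constructor 3; rewrite -oppr_gt0 -evN in neg.
    case: (H12 _ neg); rewrite evN // => Hw; case: (Hdisj (- ev v)); split=> //.
    by have -> : - ev v = - ev (u + v) + ev u by [rewrite evuv; ring]; case: (H1c _ _ Hw Hu).
  constructor 2; case: (H12 _ pos) => // Hw; case: (Hdisj (ev u)); split=> //.
  by have -> : ev u = ev (u + v) + - ev v by [rewrite evuv; ring]; case: (H2c _ _ Hw Hv).
have N_ext u v : ev u = ev v -> N u -> N v by rewrite /N => ->.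
have ND u v : N u -> N v -> N (u + v).
  move=> Nu Nv; case: (Nu) (Nv) => [u0|u1|u2] [v0|v1|v2].
  - by constructor 1; rewrite evD u0 v0 addr0.
  - by apply: N_ext Nv; rewrite evD u0 add0r.
  - by apply: N_ext Nv; rewrite evD u0 add0r.
  - by apply: N_ext Nu; rewrite evD v0 addr0.
  - by constructor 2; rewrite evD; case: (H1c _ _ u1 v1).
  - exact: Nadd_mixed.
  - by apply: N_ext Nu; rewrite evD v0 addr0.
  - by rewrite addrC; exact: Nadd_mixed.
  - by constructor 3; rewrite evD opprD; case: (H2c _ _ u2 v2).
have Ntot u : N u \/ N (- u).
  case: (ltrgtP (ev u) 0) => [neg|pos|u0]; last by left; constructor 1.
    rewrite -oppr_gt0 -evN in neg; case: (H12 _ neg) => Hu.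
      by right; constructor 2.
    by left; constructor 3; rewrite -evN.
  case: (H12 _ pos) => Hu; first by left; constructor 2.
  by right; constructor 3; rewrite evN opprK.
have N_anti u : N u -> N (- u) -> ev u = 0.
  rewrite /N evN opprK.
  case=> [//|u1|u2] [/eqP|v1|v2]; try by rewrite oppr_eq0 => /eqP.
  - by have := H1pos _ v1; rewrite oppr_gt0 ltNge ltW // H1pos.
  - by case: (Hdisj (ev u)).
  - by case: (Hdisj (- ev u)).
  - by have := H2pos _ u2; rewrite oppr_gt0 ltNge ltW // H2pos.
have Nn n u : N u -> N (u *+ n).
  move=> Nu; elim: n => [|n IHn]; last by rewrite mulrSr; exact: ND.
  by constructor 1; rewrite mulr0n /ev rmorph0 horner0.
have NZ q u : 0 <= q -> N u -> N (q *: u).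
  (* If [- q *: u] is in the cone, clearing the denominator puts a multiple of [u] and its opposite
     there, so [q *: u] vanishes at [x]. *)
  move=> q0 Nu; case: (Ntot (q *: u)) => // Nqu.
  have dn : (denq q)%:~R *: (q *: u) = u *+ `|numq q|.
    rewrite scalerA mulrC -numqE -scaler_nat.
    by rewrite natr_absz ger0_norm // numq_ge0.
  have := Nn `|denq q|%N _ Nqu; rewrite -scaler_nat natr_absz ger0_norm ?denq_ge0 //.
  rewrite scalerN dn => /(N_anti _ (Nn _ _ Nu)).
  rewrite -dn evZ => /eqP; rewrite mulf_eq0 ratr_int intr_eq0 (negPf (denq_neq0 q)).
  by move=> /eqP ?; constructor 1.
have N0 u : ev u = 0 -> N u by constructor 1.
(* [s i] is the absolute value of [x ^ i] for the order: [x ^ i] is in [H2] for [i > 0]. *)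
pose s i : {poly rat} := if i == 0%N then 1 else - 'X^i.
have evXn i : H2 (ev 'X^(i.+1)).
  elim: i => [|i IHi]; first by rewrite evX.
  by rewrite exprS evM evX; case: (H2c _ _ H2x IHi).
have Ns i : N (s i).
  rewrite /s; case: eqP => [_|]; first by constructor 2; rewrite ev1.
  by case: i => // i _; constructor 3; rewrite evN opprK.
(* The sum dominates each [s i]; the extra [1] keeps [- e] out of the cone. *)
pose e := 1 + \sum_(i < size p) s i.
have Nsum (I : finType) (P : pred I) (F : I -> {poly rat}) :
    (forall i, P i -> N (F i)) -> N (\sum_(i | P i) F i).
  by move=> NF; apply: big_ind => //; apply: N0; rewrite /ev rmorph0 horner0.
have Ne : ~ N (- e).
  have Ne1 : N (\sum_(i < size p) s i) by apply: Nsum.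
  move=> /ND/(_ Ne1); rewrite /e opprD subrK => /N_anti.
  rewrite opprK => /(_ (Ns 0%N)); rewrite evN ev1 => /eqP.
  by rewrite oppr_eq0 oner_eq0.
have e_ge (i : 'I_(size p)) : N (e - s i).
  rewrite /e (bigD1 i) //= addrCA addrAC subrr add0r.
  by apply: ND; [exact: (Ns 0%N) | apply: Nsum].
have Ndom u : exists q, N (q *: e - u).
  pose D v := exists q, N (q *: e - v).
  have DD v w : D v -> D w -> D (v + w).
    move=> [q Nq] [r Nr]; exists (q + r).
    by rewrite scalerDl opprD addrACA; exact: ND.
  (* [u] and [u %% p] agree at [x], and the remainder is a combination of the finitely many [s i] in
     [e]. *)
  have [q] : D (u %% p).
    rewrite -[X in D X]coefK poly_def.
    apply: big_ind => // [|i _]; first by exists 0; rewrite scale0r subr0; apply: N0;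
      rewrite /ev rmorph0 horner0.
    have ltip : (i < size p)%N.
      by apply: leq_trans (ltn_ord i) _; rewrite ltnW // ltn_modp.
    have [c ->] : exists c, (u %% p)`_i *: 'X^i = c *: s i.
      rewrite /s; case: eqP => [->|_]; first by exists (u %% p)`_0.
      by exists (- (u %% p)`_i); rewrite scalerN scaleNr opprK.
    have [c0|c0] := leP 0 c.
      by exists c; rewrite -scalerBr; apply: NZ => //; exact: (e_ge (Ordinal ltip)).
    exists 0; rewrite scale0r sub0r -scaleNr; apply: NZ => //.
    by rewrite oppr_ge0 ltW.
  move=> Nq; exists q; apply: N_ext Nq; rewrite !evB; congr (_ - _).
  by rewrite [in RHS](divp_eq u p) evD evM px mulr0 add0r.
have [f [fD fe fN_ge0]] := archimedean_functional R _ N e ND NZ Ntot Ndom Ne.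
have fNr u : f (- u) = - f u.
  by rewrite -scaleN1r (additive_scale_rat _ _ _ fD) rmorphN rmorph1 mulN1r.
have f1_ge0 u : H1 (ev u) -> 0 <= f u by move=> Hu; apply: fN_ge0; constructor 2.
have f2_le0 u : H2 (ev u) -> f u <= 0.
  by move=> Hu; rewrite -oppr_ge0 -fNr; apply: fN_ge0; constructor 3; rewrite evN opprK.
have f0 u : ev u = 0 -> f u = 0.
  move=> u0; apply/eqP; rewrite eq_le -oppr_ge0 -fNr !fN_ge0 //; apply: N0 => //.
  by rewrite evN u0 oppr0.
have f_sqr_ge0 u : 0 < ev u -> 0 < f u -> 0 <= f (u * u).
  move=> /H12[Hu _|/f2_le0]; last by rewrite leNgt => /negP.
  by apply: f1_ge0; rewrite evM; case: (H1c _ _ Hu Hu).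
have f_sqr_le0 u : 0 < ev u -> f u < 0 -> f (u * u) <= 0.
  move=> /H12[/f1_ge0|Hu _]; first by rewrite leNgt => /negP.
  by apply: f2_le0; rewrite evM; case: (H2c _ _ Hu Hu).
have f_eval := additive_eq_scaled_eval _ _ _ fD f_sqr_ge0 f_sqr_le0 _ p0 px f0.
(* If [f 1] were zero, [f] would vanish identically, against [f e = 1]. *)
have f1_gt0 : 0 < f 1.
  rewrite lt_def f1_ge0 ?ev1 // andbT; apply/eqP => f10.
  by have := f_eval e; rewrite fe f10 mulr0 => /eqP; rewrite oner_eq0.
have := f2_le0 'X; rewrite f_eval -/(ev _) evX => /(_ H2x).
by rewrite leNgt mulr_gt0 // H2pos.
Qed.

(** * Reduction to the subfield generated by one element *)

Theorem theorem1p2 (R : realType) (a : R) (ha : algebraic_over_Q a) :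
  ~ exists H1 H2 : R -> Prop,
      (forall x, Qadj_pos a x <-> (H1 x \/ H2 x)) /\
      (forall x, ~ (H1 x /\ H2 x)) /\
      (exists x, H1 x) /\ (exists x, H2 x) /\
      add_mul_closed H1 /\ add_mul_closed H2.
Proof.
(* [1] lies in one of the two parts; exchanging them covers the other case. *)
have key (H1 H2 : R -> Prop) (x : R) :
    (forall x, Qadj_pos a x <-> (H1 x \/ H2 x)) ->
    (forall x, ~ (H1 x /\ H2 x)) ->
    add_mul_closed H1 -> add_mul_closed H2 -> H1 1 -> H2 x -> False.
  move=> Hpart Hdisj H1c H2c H11 H2x.
  have Hpos y : H1 y \/ H2 y -> 0 < y by move=> /Hpart[].
  have [[b [c [c0 xE]]] _] : Qadj_pos a x by apply/Hpart; right.
  have a_alg : algebraicOver (@ratr R) a by have [p [? ?]] := ha; exists p.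
  have alg_eval (q : {poly rat}) : algebraicOver (@ratr R) (map_poly ratr q).[a].
    elim/poly_ind: q => [|q r IHq]; first by rewrite rmorph0 horner0; apply: algebraic0.
    rewrite rmorphD rmorphM /= map_polyX map_polyC hornerD hornerM hornerX hornerC.
    by apply: algebraic_add; [exact: algebraic_mul | exact: algebraic_id].
  have [p p0 /rootP px] : algebraicOver (@ratr R) x.
    by rewrite xE; apply: algebraic_div.
  apply: (no_partition_with_one _ x p H1 H2) => //.
  - move=> q qx; apply/Hpart; split=> //.
    (* By Horner's rule, with [x = b / c] and [q] evaluating to [u / v], the next value is
       [(u * b + r * (v * c)) / (v * c)]. *)
    elim/poly_ind: q {qx} => [|q r [u [v [v0 qE]]]].
      by exists 0, 1; rewrite !rmorph0 rmorph1 !horner0 hornerC oner_eq0 mul0r.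
    exists (u * b + r *: (v * c)), (v * c).
    rewrite !rmorphD /= !map_polyZ !rmorphM /= map_polyX map_polyC /=.
    by rewrite !hornerE mulf_neq0 // qE xE; split=> //=; field; exact/andP.
  - by move=> y ?; apply: Hpos; left.
  - by move=> y ?; apply: Hpos; right.
move=> [H1 [H2 [Hpart [Hdisj [[x1 Hx1] [[x2 Hx2] [H1c H2c]]]]]]].
have /Hpart[H11|H21] : Qadj_pos a 1.
- split; last exact: ltr01.
  by exists 1, 1; rewrite rmorph1 hornerC oner_eq0 divr1.
- exact: (key H1 H2 x2).
- apply: (key H2 H1 x1) => //; first by move=> x; rewrite Hpart; tauto.
  by move=> x [? ?]; apply: (Hdisj x).
Qed.
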